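(* Let $K_0,K_1,\dots,K_t$ ($t\ge 1$) be real matrices with $d$ rows each, let $P_j^\star$, $R_j^\star$, $\widetilde P_t$ be as defined in the context, and define $C_t = [R_1^\star, R_2^\star, \dots, R_t^\star]\in\mathbb{R}^{d\times M}$. Let $\Gamma>0$ and let $\Delta$ be any real matrix with $d$ columns satisfying $\|\Delta\|_2\le\Gamma$. Then $$\|\Delta\,\widetilde P_t\,x\| \;\le\; \Gamma\,\big\|\widetilde P_t - P_t^\star\big\|_2\,\|x\|\qquad\text{for all } x\in\mathrm{span}(C_t).$$
   Context: $\|\cdot\|_2$ is the spectral norm on matrices, $\|\cdot\|$ the Euclidean norm on vectors, and $\mathrm{span}(C_t)$ the column space of $C_t$. For $j\ge 0$, $P_j^\star\in\mathbb{R}^{d\times d}$ is the orthogonal projector onto the orthogonal complement of $\mathrm{span}(K_0,\dots,K_j)$, the column space of $[K_0,\dots,K_j]$. For $j\ge 1$, $R_j^\star=P_{j-1}^\star K_j$. $\widetilde P_t$ is the truncated projector, built with thresholds $\tau_1,\dots,\tau_t>0$: $\widetilde P_0=P_0^\star$ and, for $j\ge1$, $\widetilde P_j=\widetilde P_{j-1}-\widetilde Q_j\widetilde Q_j^\top$, where the columns of $\widetilde Q_j$ are the left singular vectors in a singular value decomposition of $\widetilde P_{j-1}K_j$ whose singular values are at least $\tau_j$. *)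

(* Defs.v *)
From mathcomp Require Import all_boot all_order all_algebra.
From mathcomp Require Import classical_sets reals.

Set Implicit Arguments.
Unset Strict Implicit.
Unset Printing Implicit Defensive.

Import Order.TTheory GRing.Theory Num.Theory.
Local Open Scope ring_scope.

Definition enorm {R : realType} {n : nat} (x : 'cV[R]_n) : R :=
  Num.sqrt (\sum_(i < n) x i 0 ^+ 2).

(* Operator norm induced by the Euclidean norm.  The set is nonempty and
   bounded above, so [sup] is not the junk value. *)
Definition specnorm {R : realType} {m n : nat} (A : 'M[R]_(m, n)) : R :=
  sup [set enorm (A *m x) | x in [set x : 'cV[R]_n | enorm x <= 1]]%classic.

(* Subspaces are row spaces in [mxalgebra], hence the transposes. *)
Definition in_colspan {R : realType} {d n : nat}
  (x : 'cV[R]_d) (A : 'M[R]_(d, n)) : bool := (x^T <= A^T)%MS.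

(* Orthogonal projector onto the orthogonal complement of the column space
   of A.  [proj_mx] acts on row vectors; here it projects onto
   {u | u *m A = 0} parallel to the row space of A^T. *)
Definition orthc_proj {R : realType} {d n : nat} (A : 'M[R]_(d, n)) : 'M[R]_d :=
  (proj_mx (kermx A) <<A^T>>%MS)^T.

Section OrthcProj.
Context {R : realType} {d n : nat}.
Implicit Type A : 'M[R]_(d, n).

Lemma rv_sqr_eq0 (u : 'rV[R]_d) : u *m u^T = 0 -> u = 0.
Proof.
move=> /matrixP/(_ 0 0); rewrite !mxE.
under eq_bigr do rewrite mxE -expr2.
move/eqP; rewrite psumr_eq0 => [/allP u0|i _]; last exact: sqr_ge0.
apply/rowP => i; rewrite mxE; apply/eqP.
by have := u0 i (mem_index_enum _); rewrite sqrf_eq0.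
Qed.

Lemma cap_kermx_tr A : (kermx A :&: <<A^T>> = 0)%MS.
Proof.
apply/row_matrixP => i; rewrite row0; apply: rv_sqr_eq0.
have := row_sub i (kermx A :&: <<A^T>>)%MS; set u := row _ _.
rewrite sub_capmx genmxE => /andP[/sub_kermxP uA /submxP[w uw]].
by rewrite {1}uw -mulmxA -trmx_mul uA trmx0 mulmx0.
Qed.

Lemma add_kermx_tr A : row_full (kermx A + <<A^T>>)%MS.
Proof.
apply/eqP; rewrite mxrank_disjoint_sum ?cap_kermx_tr // genmxE mxrank_tr.
by rewrite mxrank_ker subnK // rank_leq_row.
Qed.

Lemma orthc_proj_id A (x : 'cV[R]_d) : A^T *m x = 0 -> orthc_proj A *m x = x.
Proof.
move=> Ax; apply: trmx_inj; rewrite trmx_mul trmxK.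
apply: proj_mx_id; first exact: cap_kermx_tr.
by apply/sub_kermxP; apply: trmx_inj; rewrite trmx_mul trmxK Ax trmx0.
Qed.

Lemma tr_mul_orthc_proj A : A^T *m orthc_proj A = 0.
Proof.
apply: trmx_inj; rewrite trmx_mul !trmxK trmx0; apply/sub_kermxP.
by rewrite -[X in (X <= _)%MS]mul1mx proj_mx_sub.
Qed.

Lemma orthc_proj_mul A : orthc_proj A *m A = 0.
Proof.
apply: trmx_inj; rewrite trmx_mul trmxK trmx0.
by apply: proj_mx_0; [exact: cap_kermx_tr | rewrite genmxE].
Qed.

Lemma orthc_proj_idem A : orthc_proj A *m orthc_proj A = orthc_proj A.
Proof. by rewrite -trmx_mul proj_mx_proj // cap_kermx_tr. Qed.

Lemma orthc_proj_sym A : (orthc_proj A)^T = orthc_proj A.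
Proof.
have /submxP[W hW] : (1%:M - (orthc_proj A)^T <= A^T)%MS.
  rewrite trmxK -[X in (_ - X <= _)%MS]mul1mx -(genmxE A^T).
  by rewrite proj_mx_compl_sub // submx_full // add_kermx_tr.
have PP : orthc_proj A = (orthc_proj A)^T *m orthc_proj A.
  apply/eqP; rewrite -subr_eq0 -{1}(mul1mx (orthc_proj A)) -mulmxBl hW.
  by rewrite -mulmxA tr_mul_orthc_proj mulmx0.
by move: (orthc_proj A) PP => P PP; rewrite {1}PP trmx_mul trmxK -PP.
Qed.

End OrthcProj.

Definition Pstar {R : realType} {d : nat} {n : nat -> nat}
    (K : forall j, 'M[R]_(d, n j)) (j : nat) : 'M[R]_d :=
  orthc_proj (\mxrow_(i < j.+1) K i).

(* Meaningful for 1 <= j only. *)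
Definition Rstar {R : realType} {d : nat} {n : nat -> nat}
    (K : forall j, 'M[R]_(d, n j)) (j : nat) : 'M[R]_(d, n j) :=
  Pstar K j.-1 *m K j.

Definition Cmx {R : realType} {d : nat} {n : nat -> nat}
    (K : forall j, 'M[R]_(d, n j)) (t : nat)
    : 'M[R]_(d, \sum_(j < t) n j.+1) :=
  \mxrow_(j < t) Rstar K j.+1.

(* Thin singular value decomposition; the singular values may come in any
   order. *)
Definition is_svd {R : realType} {d n : nat} (A : 'M[R]_(d, n))
    (U : 'M[R]_(d, minn d n)) (s : 'rV[R]_(minn d n))
    (V : 'M[R]_(n, minn d n)) : Prop :=
  [/\ U^T *m U = 1%:M, V^T *m V = 1%:M, forall i, 0 <= s 0 i
    & A = U *m diag_mx s *m V^T].

Definition select_cols {R : realType} {d r : nat} (U : 'M[R]_(d, r))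
    (s : 'rV[R]_r) (tau : R) : 'M[R]_(d, #|[set i | tau <= s 0 i]%SET|) :=
  colsub enum_val U.

(* A relation rather than a function, because a singular value decomposition
   is not unique. *)
Inductive trunc_proj {R : realType} {d : nat} {n : nat -> nat}
    (K : forall j, 'M[R]_(d, n j)) (tau : nat -> R) : nat -> 'M[R]_d -> Prop :=
| trunc_proj0 : trunc_proj K tau 0 (Pstar K 0)
| trunc_projS (j : nat) (P : 'M[R]_d) U s V :
    trunc_proj K tau j P ->
    is_svd (P *m K j.+1) U s V ->
    let Q := select_cols U s (tau j.+1) in
    trunc_proj K tau j.+1 (P - Q *m Q^T).

(* Main.v *)
(** Each [Rstar K j] with [1 <= j <= t] is [K j] minus its orthogonal projection
    on the span of [K 0, ..., K (j-1)], hence is annihilated by [Pstar K t].  So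
    [Pstar K t] kills [x], [Ptilde *m x = (Ptilde - Pstar K t) *m x], and the
    bound is submultiplicativity of the spectral norm. *)
Require Import Defs.
From mathcomp Require Import all_boot all_order all_algebra.
From mathcomp Require Import classical_sets reals.

Import Order.TTheory GRing.Theory Num.Theory.
Local Open Scope ring_scope.

Lemma enorm_ge0 (R : realType) (n : nat) (x : 'cV[R]_n) : 0 <= enorm x.
Proof. exact: sqrtr_ge0. Qed.

Lemma enorm0 (R : realType) (n : nat) : enorm (0 : 'cV[R]_n) = 0.
Proof. by rewrite /enorm big1 ?sqrtr0 // => i _; rewrite mxE expr0n. Qed.

Lemma enorm_eq0 (R : realType) (n : nat) (x : 'cV[R]_n) : enorm x = 0 -> x = 0.
Proof.
move=> /eqP; rewrite sqrtr_eq0 => x0.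
have : \sum_(i < n) x i 0 ^+ 2 == 0.
  by rewrite eq_le x0 sumr_ge0 // => i _; exact: sqr_ge0.
rewrite psumr_eq0 => [/allP xi0|i _]; last exact: sqr_ge0.
apply/colP => i; rewrite mxE; apply/eqP.
by have := xi0 i (mem_index_enum _); rewrite sqrf_eq0.
Qed.

Lemma enormZ (R : realType) (n : nat) (a : R) (x : 'cV[R]_n) :
  enorm (a *: x) = `|a| * enorm x.
Proof.
rewrite /enorm -sqrtr_sqr -sqrtrM ?sqr_ge0 // mulr_sumr.
by congr Num.sqrt; apply: eq_bigr => i _; rewrite mxE exprMn.
Qed.

Lemma coord_le_enorm (R : realType) (n : nat) (x : 'cV[R]_n) (i : 'I_n) :
  `|x i 0| <= enorm x.
Proof.
rewrite -sqrtr_sqr ler_wsqrtr // (bigD1 i) //= lerDl.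
by apply: sumr_ge0 => j _; exact: sqr_ge0.
Qed.

(** Needed before [sup] can be used as an upper bound, since its value is a default one on sets
    without a supremum. *)
Lemma specnorm_has_sup (R : realType) (m n : nat) (A : 'M[R]_(m, n)) :
  has_sup [set enorm (A *m x) | x in [set x : 'cV[R]_n | enorm x <= 1]]%classic.
Proof.
split; first by exists (enorm (A *m 0)); exists 0; rewrite //= enorm0 ler01.
(* A crude bound suffices: coordinates in the unit ball are at most 1 in absolute value, so entry
   [i] of [A *m x] is at most the l1 norm of row [i]. *)
exists (Num.sqrt (\sum_(i < m) (\sum_(j < n) `|A i j|) ^+ 2)).
move=> _ [x /= x1 <-]; apply: ler_wsqrtr; apply: ler_sum => i _.
rewrite -real_normK ?num_real // lerXn2r ?nnegrE ?sumr_ge0 //.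
rewrite mxE (le_trans (ler_norm_sum _ _ _)) //; apply: ler_sum => j _.
by rewrite normrM ler_piMr // (le_trans (coord_le_enorm _ _ _ _)).
Qed.

Lemma enorm_mulmx_le (R : realType) (m n : nat) (A : 'M[R]_(m, n))
    (x : 'cV[R]_n) :
  enorm (A *m x) <= specnorm A * enorm x.
Proof.
have [/enorm_eq0 ->|x0] := eqVneq (enorm x) 0.
  by rewrite mulmx0 !enorm0 mulr0.
have x_gt0 : 0 < enorm x by rewrite lt_def x0 enorm_ge0.
(* By homogeneity the claim reduces to the unit vector [(enorm x)^-1 *: x], a member of the set
   defining [specnorm]. *)
rewrite -ler_pdivrMr // mulrC -(ger0_norm (ltW _) : `|(enorm x)^-1| = _).
  rewrite -enormZ scalemxAr; apply: ub_le_sup.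
    by case: (specnorm_has_sup _ _ _ A).
  exists ((enorm x)^-1 *: x) => //=.
  by rewrite enormZ ger0_norm ?invr_ge0 ?enorm_ge0 // mulVf.
by rewrite invr_gt0.
Qed.

Lemma Pstar_mul_K (R : realType) (d : nat) (n : nat -> nat)
    (K : forall j, 'M[R]_(d, n j)) (t i : nat) :
  (i <= t)%N -> Pstar K t *m K i = 0.
Proof.
move=> it; have := orthc_proj_mul (\mxrow_(i < t.+1) K i).
rewrite mul_mxrow => PK0.
have /= <- := mxrowK (fun i : 'I_t.+1 => Pstar K t *m K i) (Ordinal (it : i < t.+1)%N).
by rewrite PK0 submxrow0.
Qed.

(** The range of [Pstar K t] is orthogonal to [K 0, ..., K i], so [Pstar K i] fixes it; transposing,
    by symmetry of both projectors, gives the product in this order. *)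
Lemma Pstar_mul_Pstar (R : realType) (d : nat) (n : nat -> nat)
    (K : forall j, 'M[R]_(d, n j)) (t i : nat) :
  (i <= t)%N -> Pstar K t *m Pstar K i = Pstar K t.
Proof.
move=> it; apply: trmx_inj; rewrite trmx_mul !orthc_proj_sym.
(* [orthc_proj_id] concerns single column vectors, so the equality is checked column by column,
   through rows of transposes. *)
apply: trmx_inj; apply/row_matrixP => k; apply: trmx_inj.
rewrite -!tr_col !trmxK !colE -mulmxA; apply: orthc_proj_id.
rewrite mulmxA -[X in _ *m X *m _]orthc_proj_sym -trmx_mul mul_mxrow.
rewrite (_ : \mxrow_j _ = 0) ?trmx0 ?mul0mx //.
apply/mxrowP => j; rewrite mxrowK submxrow0.
by apply: Pstar_mul_K; rewrite (leq_trans _ it) // -ltnS.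
Qed.

Lemma Pstar_mul_Cmx (R : realType) (d : nat) (n : nat -> nat)
    (K : forall j, 'M[R]_(d, n j)) (t : nat) :
  Pstar K t *m Cmx K t = 0.
Proof.
rewrite mul_mxrow; apply/mxrowP => j; rewrite mxrowK submxrow0.
(* Block [j] is [Pstar K t *m (Pstar K j *m K j.+1)]; as [j < t], the inner projector is absorbed
   and [K j.+1] is still among the annihilated blocks. *)
by rewrite mulmxA Pstar_mul_Pstar ?Pstar_mul_K ?(ltnW (ltn_ord j)).
Qed.

Theorem corollary4p3 (R : realType) (d t : nat) (n : nat -> nat)
    (K : forall j : nat, 'M[R]_(d, n j)) (tau : nat -> R)
    (Ptilde : 'M[R]_d) (m : nat) (Gamma : R) (Delta : 'M[R]_(m, d)) :
  (1 <= t)%N ->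
  (forall j : nat, (1 <= j <= t)%N -> 0 < tau j) ->
  trunc_proj K tau t Ptilde ->
  0 < Gamma ->
  specnorm Delta <= Gamma ->
  forall x : 'cV[R]_d, in_colspan x (Cmx K t) ->
    enorm (Delta *m Ptilde *m x)
      <= Gamma * specnorm (Ptilde - Pstar K t) * enorm x.
Proof.
move=> _ _ _ Gamma_gt0 Delta_le x /submxP[w xw].
have Px0 : Pstar K t *m x = 0.
  by rewrite -(trmxK x) xw trmx_mul trmxK mulmxA Pstar_mul_Cmx mul0mx.
have -> : Delta *m Ptilde *m x = Delta *m ((Ptilde - Pstar K t) *m x).
  by rewrite mulmxBl Px0 subr0 mulmxA.
(* The operator bound is used twice, first for [Delta] and then for [Ptilde - Pstar K t]. *)
apply: le_trans (enorm_mulmx_le _ _ _ _ _) _.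
apply: (le_trans (ler_wpM2r (enorm_ge0 _ _ _) Delta_le)).
by rewrite -mulrA ler_wpM2l ?enorm_mulmx_le // ltW.
Qed.
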